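(* Let $\mathbf{k}$ be an algebraically closed field of characteristic zero and let $\Delta$ be a simplicial complex on $[n]$. The following are equivalent: (a) $X_\Delta$ is rigid; (b) $\Delta$ is fully hidden; (c) every face of $\Delta$ is an intersection of facets.
   Context: $\mathbf{k}$ is an algebraically closed field of characteristic zero. For $n\ge 1$, $[n]=\{1,\dots,n\}$. A simplicial complex $\Delta$ on $[n]$ is a collection of subsets of $[n]$ (faces) closed under taking subsets; it is always assumed that $\{i\}\in\Delta$ for every $i\in[n]$. Facets are the inclusion-maximal faces; $\mathcal F(\Delta)$ is the set of facets, and $\mathcal F_\sigma(\Delta)=\{F\in\mathcal F(\Delta):\sigma\subseteq F\}$ for $\sigma\subseteq[n]$. In (c), intersections are over nonempty families of facets. For a face $S$, $\operatorname{cl}(S)=\bigcap_{F\in\mathcal F_S(\Delta)}F$. For $i\in[n]$, $\mathcal A_i(\Delta)=\{S\subseteq[n]\setminus\{i\}: S\in\Delta,\ i\in\operatorname{cl}(S)\}$. A facet $F$ is exposed if there exist $i\in[n]$ and $S\in\mathcal A_i(\Delta)$ with $S\subseteq F$, and hidden otherwise. $\Delta$ is fully hidden if every facet is hidden. $\mathbf k[\Delta]=\mathbf k[x_1,\dots,x_n]/I_\Delta$ with $I_\Delta=(\prod_{i\in\sigma}x_i:\sigma\subseteq[n],\sigma\notin\Delta)$, and $X_\Delta=\operatorname{Spec}\mathbf k[\Delta]$. $X_\Delta$ is rigid if it admits no nontrivial regular action of the additive group $\mathbb G_{\mathrm a}=(\mathbf k,+)$, i.e. no nontrivial group action given by a morphism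 of varieties $\mathbb G_{\mathrm a}\times X_\Delta\to X_\Delta$. *)

(* Defs.v *)
From HB Require Import structures.
From mathcomp Require Import all_boot all_order all_algebra.
From mathcomp Require Import ring_quotient mpoly.
From mathcomp Require Import boolp.

Set Implicit Arguments.
Unset Strict Implicit.
Unset Printing Implicit Defensive.

Import GRing.Theory.

Local Open Scope ring_scope.
Local Open Scope quotient_scope.

(* [set0_face] follows from the other two axioms as soon as 0 < n; it is     *)
(* recorded so that the face ring below is nontrivial for every n.           *)
Record simplicial_complex (n : nat) := SimplicialComplex {
  faces :> {set {set 'I_n}};
  face_closed : forall S T : {set 'I_n}, T \in faces -> S \subset T -> S \in faces;
  vertex_face : forall i : 'I_n, [set i] \in faces;
  set0_face : set0 \in faces
}.

Definition facets (n : nat) (Delta : simplicial_complex n) : {set {set 'I_n}} :=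
  [set F | maxset (fun S => S \in faces Delta) F].

Definition facets_over (n : nat) (Delta : simplicial_complex n)
    (S : {set 'I_n}) : {set {set 'I_n}} :=
  [set F in facets Delta | S \subset F].

(* For a face S the family [facets_over Delta S] is nonempty. *)
Definition cl (n : nat) (Delta : simplicial_complex n) (S : {set 'I_n}) :
    {set 'I_n} :=
  \bigcap_(F in facets_over Delta S) F.

Definition exposing (n : nat) (Delta : simplicial_complex n) (i : 'I_n) :
    {set {set 'I_n}} :=
  [set S : {set 'I_n} |
    [&& S \subset ~: [set i], S \in faces Delta & i \in cl Delta S]].

Definition exposed (n : nat) (Delta : simplicial_complex n)
    (F : {set 'I_n}) : bool :=
  (F \in facets Delta) &&
  [exists i : 'I_n, exists S in exposing Delta i, S \subset F].

Definition hidden (n : nat) (Delta : simplicial_complex n)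
    (F : {set 'I_n}) : bool :=
  (F \in facets Delta) && ~~ exposed Delta F.

Definition fully_hidden (n : nat) (Delta : simplicial_complex n) : Prop :=
  forall F : {set 'I_n}, F \in facets Delta -> hidden Delta F.

Definition faces_are_intersections_of_facets (n : nat)
    (Delta : simplicial_complex n) : Prop :=
  forall S : {set 'I_n}, S \in faces Delta ->
    exists G : {set {set 'I_n}},
      [/\ G != set0, G \subset facets Delta & S = \bigcap_(F in G) F].

(* The finite family of squarefree monomials \prod_(i in s) x_i, for s not a *)
(* face, generates I_Delta: its elements are the {mpoly k[n]}-linear         *)
(* combinations of that family.                                              *)
Definition SR_ideal (k : fieldType) (n : nat) (Delta : simplicial_complex n) :
    {pred {mpoly k[n]}} :=
  fun p => `[< exists c : {set 'I_n} -> {mpoly k[n]},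
    p = \sum_(s : {set 'I_n} | s \notin faces Delta)
          c s * \prod_(i in s) 'X_i >].
Arguments SR_ideal k {n} Delta.

Lemma SR_ideal_closed (k : fieldType) (n : nat) (Delta : simplicial_complex n) :
  idealr_closed (SR_ideal k Delta).
Proof.
split.
- apply/asboolP; exists (fun=> 0).
  by rewrite big1 // => s _; rewrite mul0r.
- apply/asboolP => -[c /(congr1 (meval (fun=> 0)))].
  rewrite meval1 rmorph_sum big1 => [/eqP|s sND]; first by rewrite oner_eq0.
  have [i si] : exists i, i \in s.
    by apply/set0Pn; apply: contraNneq sND => ->; exact: set0_face.
  by rewrite /= mevalM (bigD1 i) //= mevalM mevalXU mul0r mulr0.
- move=> a p q /asboolP[c ->] /asboolP[d ->]; apply/asboolP.
  exists (fun s => a * c s + d s).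
  rewrite mulr_sumr -big_split; apply: eq_bigr => s _ /=.
  by rewrite mulrDl mulrA.
Qed.

HB.instance Definition _ (k : fieldType) (n : nat)
    (Delta : simplicial_complex n) :=
  isIdealr.Build {mpoly k[n]} (SR_ideal k Delta) (@SR_ideal_closed k n Delta).

Definition face_ring (k : fieldType) (n : nat) (Delta : simplicial_complex n) :
    Type :=
  {ideal_quot (SR_ideal k Delta)}.
Arguments face_ring k {n} Delta.

HB.instance Definition _ (k : fieldType) (n : nat)
    (Delta : simplicial_complex n) :=
  GRing.ComNzRing.copy (face_ring k Delta) {ideal_quot (SR_ideal k Delta)}.

Definition face_ring_pi (k : fieldType) (n : nat) (Delta : simplicial_complex n)
    (p : {mpoly k[n]}) : face_ring k Delta :=
  \pi_{ideal_quot (SR_ideal k Delta)} p.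
Arguments face_ring_pi {k n} Delta p.

Lemma face_ring_pi_is_zmod_morphism (k : fieldType) (n : nat)
    (Delta : simplicial_complex n) :
  zmod_morphism (@face_ring_pi k n Delta).
Proof. by move=> p q; rewrite /face_ring_pi rmorphB. Qed.

Lemma face_ring_pi_is_monoid_morphism (k : fieldType) (n : nat)
    (Delta : simplicial_complex n) :
  monoid_morphism (@face_ring_pi k n Delta).
Proof.
by split=> [|p q]; rewrite /face_ring_pi; [rewrite rmorph1 | rewrite rmorphM].
Qed.

HB.instance Definition _ (k : fieldType) (n : nat)
    (Delta : simplicial_complex n) :=
  GRing.isZmodMorphism.Build {mpoly k[n]} (face_ring k Delta)
    (face_ring_pi Delta) (@face_ring_pi_is_zmod_morphism k n Delta).
HB.instance Definition _ (k : fieldType) (n : nat)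
    (Delta : simplicial_complex n) :=
  GRing.isMonoidMorphism.Build {mpoly k[n]} (face_ring k Delta)
    (face_ring_pi Delta) (@face_ring_pi_is_monoid_morphism k n Delta).

Definition face_ring_scale (k : fieldType) (n : nat)
    (Delta : simplicial_complex n) (a : k) (u : face_ring k Delta) :
    face_ring k Delta :=
  face_ring_pi Delta a%:MP * u.

Lemma face_ring_scaleA (k : fieldType) (n : nat) (Delta : simplicial_complex n)
    (a b : k) (u : face_ring k Delta) :
  face_ring_scale a (face_ring_scale b u) = face_ring_scale (a * b) u.
Proof. by rewrite /face_ring_scale mulrA -!rmorphM. Qed.

Lemma face_ring_scale1 (k : fieldType) (n : nat) (Delta : simplicial_complex n) :
  left_id 1 (@face_ring_scale k n Delta).
Proof. by move=> u; rewrite /face_ring_scale !rmorph1 mul1r. Qed.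

Lemma face_ring_scaleDr (k : fieldType) (n : nat)
    (Delta : simplicial_complex n) :
  right_distributive (@face_ring_scale k n Delta) +%R.
Proof. by move=> a u v; rewrite /face_ring_scale mulrDr. Qed.

Lemma face_ring_scaleDl (k : fieldType) (n : nat)
    (Delta : simplicial_complex n) (u : face_ring k Delta) :
  {morph (@face_ring_scale k n Delta)^~ u : a b / a + b}.
Proof. by move=> a b; rewrite /face_ring_scale !rmorphD mulrDl. Qed.

HB.instance Definition _ (k : fieldType) (n : nat)
    (Delta : simplicial_complex n) :=
  GRing.Zmodule_isLmodule.Build k (face_ring k Delta)
    (@face_ring_scaleA k n Delta) (@face_ring_scale1 k n Delta)
    (@face_ring_scaleDr k n Delta) (@face_ring_scaleDl k n Delta).

Lemma face_ring_scaleAl (k : fieldType) (n : nat)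
    (Delta : simplicial_complex n) (a : k) (u v : face_ring k Delta) :
  a *: (u * v) = (a *: u) * v.
Proof. exact: mulrA. Qed.

HB.instance Definition _ (k : fieldType) (n : nat)
    (Delta : simplicial_complex n) :=
  GRing.Lmodule_isLalgebra.Build k (face_ring k Delta)
    (@face_ring_scaleAl k n Delta).
HB.instance Definition _ (k : fieldType) (n : nat)
    (Delta : simplicial_complex n) :=
  GRing.Lalgebra_isComAlgebra.Build k (face_ring k Delta).

(* The variety Spec A of a reduced finitely generated algebra A over an      *)
(* algebraically closed field k: its (closed) points are the k-algebra       *)
(* morphisms x : A -> k, and g : A is the regular function x |-> x g.        *)
Definition point (k : fieldType) (A : comAlgType k) : Type :=
  {lrmorphism A -> k | *%R}.

(* The coordinate ring of the product k x Spec A is k[t] (x) A = A[t], where *)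
(* q : A[t] takes at (t, x) the value obtained by applying x to the          *)
(* coefficients of q and evaluating at t.                                    *)
Definition regular_on_line_times (k : fieldType) (A : comAlgType k)
    (h : k -> point A -> k) : Prop :=
  exists q : {poly A}, forall (t : k) (x : point A), h t x = (map_poly x q).[t].

(* A map of affine varieties is a morphism when it pulls regular functions   *)
(* back to regular functions.                                                *)
Definition line_times_morphism (k : fieldType) (A : comAlgType k)
    (mu : k -> point A -> point A) : Prop :=
  forall g : A, regular_on_line_times (fun t x => mu t x g).

Definition additive_group_action (k : fieldType) (T : Type) (mu : k -> T -> T) :
    Prop :=
  (forall x : T, mu 0 x = x) /\
  (forall (s t : k) (x : T), mu (s + t) x = mu s (mu t x)).

Definition nontrivial_action (k : fieldType) (T : Type) (mu : k -> T -> T) :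
    Prop :=
  exists (t : k) (x : T), mu t x <> x.

Definition rigid (k : fieldType) (A : comAlgType k) : Prop :=
  ~ exists mu : k -> point A -> point A,
      [/\ line_times_morphism mu, additive_group_action mu
        & nontrivial_action mu].

(* Main.v *)
Require Import Defs.
From HB Require Import structures.
From mathcomp Require Import all_boot all_order all_algebra.
From mathcomp Require Import ring_quotient mpoly boolp.

Set Implicit Arguments.
Unset Strict Implicit.
Unset Printing Implicit Defensive.

Import GRing.Theory.

Local Open Scope ring_scope.

(** Both combinatorial conditions say that every face equals its closure: a
    vertex of [cl S] outside [S] exposes a facet through [S], and a face that is
    an intersection of facets is the intersection of all facets above it.  So
    the theorem compares rigidity with the absence of non-closed faces.  Throughout,
    a point of the face variety is identified with its coordinate vector: the
    vectors that arise are those whose support is a face ([coord_support_face],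
    [point_exists]), and the vector determines the point ([point_ext]).

    If [S] exposes along [i], the flow [v |-> v + t * (\prod_(l in S) v l) * e_i]
    is a nontrivial action ([exposed_not_rigid]).  It stays in the variety
    because where the product is nonzero the support contains [S], and every
    facet above [S] contains [i]; it is additive in [t] because the product does
    not involve the coordinate [i].

    Conversely, suppose that every face is closed and let the additive group
    act.  The linear subspaces of vectors supported on a facet are the
    irreducible components of the variety, and a connected group preserves each
    of them ([facet_invariant]).  Closedness turns this into: every coordinate
    subspace of the variety is preserved, so a vanishing coordinate vanishes
    along the whole orbit ([zero_coord_fixed]).  Since the action can be
    reversed, a nonzero coordinate never vanishes along an orbit; but it is a
    polynomial in the time, and over an algebraically closed field a polynomial
    without roots is constant.  Hence the action is trivial
    ([action_trivial]). *)

(** * Closures of faces *)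

Lemma facet_above (n : nat) (Delta : simplicial_complex n) (S : {set 'I_n}) :
  S \in faces Delta -> exists F, F \in facets_over Delta S.
Proof.
case/(@maxset_exists _ (fun T => T \in faces Delta)) => F maxF SF.
by exists F; rewrite !inE maxF.
Qed.

Lemma sub_cl (n : nat) (Delta : simplicial_complex n) (S : {set 'I_n}) :
  S \subset cl Delta S.
Proof. by apply/bigcapsP => F; rewrite inE => /andP[]. Qed.

Lemma facet_face (n : nat) (Delta : simplicial_complex n) (F : {set 'I_n}) :
  F \in facets Delta -> F \in faces Delta.
Proof. by rewrite inE => /maxsetp. Qed.

Lemma facet_max (n : nat) (Delta : simplicial_complex n) (F : {set 'I_n})
    (j : 'I_n) :
  F \in facets Delta -> j \notin F -> j |: F \notin faces Delta.
Proof.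
rewrite inE => /maxsetP[_ maxF] jF; apply/negP => /maxF/(_ (subsetUr _ _)) E.
by move/negP: jF; apply; rewrite -E setU11.
Qed.

(** A vertex of [cl S] outside [S] is precisely what makes [S] exposing, and
    some facet contains [S], so that facet is exposed. *)
Lemma hidden_clP (n : nat) (Delta : simplicial_complex n) :
  fully_hidden Delta <-> (forall S, S \in faces Delta -> cl Delta S = S).
Proof.
split=> [hid S SD | clE F FD].
- apply/eqP; rewrite eqEsubset sub_cl andbT; apply/subsetP => i icl.
  have [F] := facet_above SD; rewrite inE => /andP[FD SF].
  case: (boolP (i \in S)) => // iS.
  have /andP[_ /negP[]] := hid F FD; rewrite /exposed FD /=.
  apply/existsP; exists i; apply/existsP; exists S.
  by rewrite SF inE subsetC sub1set inE iS SD icl.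
- rewrite /hidden FD /exposed FD /=.
  apply/existsP => -[i /existsP[S]]; rewrite inE => /andP[/and3P[Si SD icl] _].
  move: icl; rewrite (clE S SD) => /(subsetP Si).
  by rewrite !inE eqxx.
Qed.

(** Facets whose intersection is [S] are among the facets above [S], so
    intersecting all of the latter cannot give more than [S]. *)
Lemma intersections_clP (n : nat) (Delta : simplicial_complex n) :
  faces_are_intersections_of_facets Delta <->
  (forall S, S \in faces Delta -> cl Delta S = S).
Proof.
split=> [int S SD | clE S SD].
- have [G [_ GD SG]] := int S SD.
  apply/eqP; rewrite eqEsubset sub_cl andbT {2}SG.
  apply/bigcapsP => F FG; apply: bigcap_inf.
  by rewrite inE (subsetP GD) //= SG bigcap_inf.
- exists (facets_over Delta S); split.
  + by have [F FS] := facet_above SD; apply/set0Pn; exists F.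
  + by apply/subsetP => F; rewrite inE => /andP[].
  + by rewrite -[RHS]/(cl Delta S) clE.
Qed.

(** * Polynomials as functions *)

Lemma poly_vanish_eq0 (k : closedFieldType) (p : {poly k}) :
  (forall a, p.[a] = 0) -> p = 0.
Proof.
move=> p0; apply/eqP/negPn/closed_nonrootP => -[a].
by rewrite rootE p0 eqxx.
Qed.

Lemma poly2_vanish_eq0 (k : closedFieldType) (Q : {poly {poly k}}) :
  (forall t s : k, Q.[t%:P].[s] = 0) -> Q = 0.
Proof.
move=> Q0; apply/polyP => i; rewrite coef0; apply: poly_vanish_eq0 => s.
suff: map_poly (horner_eval s) Q = 0.
  by move/(congr1 (fun p : {poly k} => p`_i)); rewrite coef_map coef0.
apply: poly_vanish_eq0 => t; rewrite -(Q0 t s) -[RHS]/(horner_eval s _).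
by rewrite -horner_map /= /horner_eval hornerC.
Qed.

(** Algebraic closedness enters rigidity here: a coordinate that moves
    polynomially along an orbit and avoids 0 does not move at all. *)
Lemma poly_no_root_const (k : closedFieldType) (p : {poly k}) (a b : k) :
  (forall t, p.[t] != 0) -> p.[a] = p.[b].
Proof.
move=> p0; have /eqP/size_poly1P[c _ ->] : size p = 1.
  by apply/eqP/negPn/closed_rootP => -[t]; rewrite rootE (negPf (p0 t)).
by rewrite !hornerC.
Qed.

(** The universal property of polynomial rings, uniqueness part; it reduces
    every comparison of evaluations below to constants and variables. *)
Lemma mpoly_rmorph_ext (k : comNzRingType) (n : nat) (S : comNzRingType)
    (f g : {rmorphism {mpoly k[n]} -> S}) :
  (forall c, f c%:MP = g c%:MP) -> (forall i, f 'X_i = g 'X_i) -> f =1 g.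
Proof.
move=> fgC fgX; elim/mpolyind => [|c m p _ _ IH]; first by rewrite !rmorph0.
rewrite !rmorphD IH -mul_mpolyC !rmorphM fgC mpolyXE_id !rmorph_prod.
by congr (_ * _ + _); apply: eq_bigr => i _; rewrite !rmorphXn /= fgX.
Qed.

(** A family of polynomials [h i] over [B] is a map from the line times the
    spectrum of [B] to affine space; the lemma computes the pull-back of [p]
    along it, and so shows that a map given by such formulas is a morphism. *)
Lemma meval_line_subst (k B : comNzRingType) (n : nat) (f : {rmorphism k -> B})
    (x : {rmorphism B -> k}) (h : 'I_n -> {poly B}) (t : k) (p : {mpoly k[n]}) :
  cancel f x ->
  p.@[fun i => (map_poly x (h i)).[t]] =
    (map_poly x (mmap (polyC \o f) h p)).[t].
Proof.
move=> fK; pose ev := horner_eval t \o (map_poly x \o mmap (polyC \o f) h).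
apply: (@mpoly_rmorph_ext k n k (meval _) ev) => [c|i] /=.
  by rewrite mevalC mmapC /= map_polyC /= /horner_eval hornerC fK.
by rewrite mevalXU mmapX mmap1U.
Qed.

Lemma horner_map_affine (k B : comNzRingType) (x : {rmorphism B -> k})
    (a c : B) (m : nat) (t : k) :
  (map_poly x (a%:P + m%:R * ('X * c%:P))).[t] = x a + m%:R * (t * x c).
Proof.
rewrite rmorphD !rmorphM /= map_polyX !map_polyC rmorph_nat !hornerE.
by rewrite -polyC_natr hornerC.
Qed.

(** * Points of the face variety *)

Section Points.
Context (k : closedFieldType) (n : nat) (Delta : simplicial_complex n).
Local Notation A := (face_ring k Delta).
Implicit Types (x y : point A) (v : 'I_n -> k).

Definition coord x : 'I_n -> k := fun i => x (face_ring_pi Delta 'X_i).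

Definition coord_support v : {set 'I_n} := [set i | v i != 0].

Lemma face_ring_piK : cancel (fun u : A => repr u) (face_ring_pi Delta).
Proof. by move=> u; rewrite /face_ring_pi reprK. Qed.

Lemma point_pi x (p : {mpoly k[n]}) : x (face_ring_pi Delta p) = p.@[coord x].
Proof.
apply: (@mpoly_rmorph_ext k n k (x \o face_ring_pi Delta) (meval (coord x))).
- move=> c /=; rewrite mevalC -[face_ring_pi _ _]mulr1.
  by rewrite -[_ * 1]/(c *: (1 : A)) linearZ /= rmorph1 mulr1.
- by move=> i /=; rewrite mevalXU.
Qed.

(** The face ring is generated by the classes of the variables.  Leibniz equality
    of bundled morphisms also needs irrelevance of their proof components. *)
Lemma point_ext x y : coord x =1 coord y -> x = y.
Proof.
move=> xy; have {xy} : (x : A -> k) = y.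
  apply: funext => u; rewrite -[u]face_ring_piK !point_pi.
  exact: meval_eq.
case: x y => [f cf] [g cg] /= fg; case: _ / fg in cg *.
congr GRing.LRMorphism.Pack.
case: cf cg => [[a1] [a2] [a3]] [[b1] [b2] [b3]].
by rewrite (Prop_irrelevance a1 b1) (Prop_irrelevance a2 b2)
           (Prop_irrelevance a3 b3).
Qed.

(** If the support were not a face, the product of its variables would be zero
    in the face ring, yet have a nonzero value at [x]. *)
Lemma coord_support_face x : coord_support (coord x) \in faces Delta.
Proof.
apply: contraT => sND.
suff /eqP : \prod_(i in coord_support (coord x)) coord x i = 0.
  by rewrite prodf_seq_eq0 => /hasP[i _ /andP[]]; rewrite inE => /negPf->.
rewrite /coord -!rmorph_prod /=.
set p := \prod_(i in _) _; suff -> : face_ring_pi Delta p = 0 by rewrite rmorph0.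
rewrite -(rmorph0 (face_ring_pi Delta)); apply/eqP.
rewrite /face_ring_pi -Quotient.idealrBE subr0; apply/asboolP.
exists (fun s => (s == coord_support (coord x))%:R).
rewrite (bigD1 (coord_support (coord x))) //= eqxx mul1r.
rewrite [X in _ + X]big1 ?addr0 // => s /andP[_ /negPf->].
by rewrite mul0r.
Qed.

(** A non-face is not contained in the support, so its monomial has a vanishing
    factor. *)
Lemma meval_SR_ideal v (p : {mpoly k[n]}) :
  coord_support v \in faces Delta -> p \in SR_ideal k Delta -> p.@[v] = 0.
Proof.
move=> vD /asboolP[c ->]; rewrite rmorph_sum big1 // => s sND.
have /subsetPn[i si] : ~~ (s \subset coord_support v).
  by apply: contra sND; apply: face_closed.
rewrite inE negbK => /eqP vi.
by rewrite /= mevalM (bigD1 i) //= mevalM mevalXU vi mul0r mulr0.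
Qed.

Lemma point_exists v :
  coord_support v \in faces Delta -> exists x, coord x =1 v.
Proof.
move=> vD; pose ev (u : A) := (repr u).@[v].
have evE p : ev (face_ring_pi Delta p) = p.@[v].
  apply/eqP; rewrite -subr_eq0 -mevalB; apply/eqP/meval_SR_ideal => //.
  by rewrite Quotient.idealrBE; apply/eqP; rewrite reprK.
have evB : zmod_morphism ev.
  move=> a b; rewrite -[a]face_ring_piK -[b]face_ring_piK -rmorphB !evE.
  exact: mevalB.
have evM : monoid_morphism ev.
  split=> [|a b]; first by rewrite -(rmorph1 (face_ring_pi Delta)) evE meval1.
  rewrite -[a]face_ring_piK -[b]face_ring_piK -rmorphM !evE; exact: mevalM.
have evZ : scalable_for *%R ev.
  move=> c a; rewrite -[a]face_ring_piK -[c *: _]rmorphM !evE.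
  by rewrite mevalM mevalC.
pose addM := GRing.isZmodMorphism.Build A k ev evB.
pose mulM := GRing.isMonoidMorphism.Build A k ev evM.
pose scM := GRing.isScalable.Build k A k *%R ev evZ.
pose x : point A := HB.pack ev addM mulM scM.
by exists x => i; rewrite /coord /= evE mevalXU.
Qed.

(** * The action of an exposing face *)

(** The flow of the locally nilpotent derivation [x^S d/dx_i]. *)
Lemma exposed_not_rigid (i : 'I_n) (S : {set 'I_n}) :
  S \in exposing Delta i -> ~ rigid A.
Proof.
rewrite inE => /and3P[Si SD icl]; apply.
have iS : i \notin S by move: Si; rewrite subsetC sub1set inE.
pose w t v j := v j + (j == i)%:R * (t * \prod_(l in S) v l).
have wS t v : \prod_(l in S) w t v l = \prod_(l in S) v l.
  apply: eq_bigr => l lS; rewrite /w; case: eqP => [li|_].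
    by rewrite li (negPf iS) in lS.
  by rewrite mul0r addr0.
have wD t x : coord_support (w t (coord x)) \in faces Delta.
  (* Outside the locus where all coordinates in S are nonzero, the flow rests. *)
  have [Sx|] := boolP (S \subset coord_support (coord x)); last first.
    case/subsetPn => l lS; rewrite inE negbK => /eqP xl.
    suff -> : w t (coord x) = coord x by apply: coord_support_face.
    apply: funext => j; rewrite /w (bigD1 l) //= xl.
    by rewrite mul0r !mulr0 addr0.
  have [F] := facet_above (coord_support_face x).
  rewrite inE => /andP[FD xF]; apply: (face_closed (facet_face FD)).
  apply/subsetP => j; rewrite inE /w; have [->|_] := eqVneq j i.
    move/bigcapP: icl => /(_ F) + _; apply.
    by rewrite inE FD (subset_trans Sx).
  by rewrite mul0r addr0 => xj; apply: (subsetP xF); rewrite inE.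
pose mu t x := projT1 (cid (point_exists (wD t x))).
have muE t x : coord (mu t x) =1 w t (coord x) by rewrite /mu; case: cid.
exists mu; split.
- move=> g.
  pose f : {rmorphism k -> A} := face_ring_pi Delta \o @mpolyC n k.
  pose h j : {poly A} := (face_ring_pi Delta 'X_j)%:P +
    (j == i)%:R * ('X * (face_ring_pi Delta (\prod_(l in S) 'X_l))%:P).
  exists (mmap (polyC \o f) h (repr g)) => t x.
  rewrite -[in LHS](face_ring_piK g) point_pi.
  rewrite -meval_line_subst => [|a]; last by rewrite /f /= point_pi mevalC.
  by apply: meval_eq => j; rewrite muE /w /h horner_map_affine !rmorph_prod.
- split=> [x|s t x]; apply: point_ext => j.
    by rewrite muE /w mul0r mulr0 addr0.
  rewrite [LHS]muE [RHS]muE /w (_ : coord (mu t x) = w t (coord x)); last first.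
    by apply: funext => l; rewrite muE.
  by rewrite wS /w -addrA -mulrDr -mulrDl [s + t]addrC.
- (* At the indicator vector of S, coordinate i moves from 0 to 1 in time 1. *)
  pose v j : k := (j \in S)%:R.
  have vS : coord_support v = S.
    by apply/setP => j; rewrite inE /v; case: (j \in S); rewrite ?oner_eq0 ?eqxx.
  have vD : coord_support v \in faces Delta by rewrite vS.
  have [x xv] := point_exists vD.
  exists 1, x => /(congr1 (fun y => coord y i)); rewrite muE /w eqxx !mul1r.
  rewrite xv /v (negPf iS) add0r => /eqP.
  by rewrite big1 ?oner_eq0 // => l lS; rewrite xv /v lS.
Qed.

(** * Actions when all faces are closed *)

Section Action.
Context (mu : k -> point A -> point A) (mu_morph : line_times_morphism mu)
  (mu_act : additive_group_action mu).

Lemma orbit_poly x j : exists p : {poly k}, forall t, coord (mu t x) j = p.[t].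
Proof.
have [q qE] := mu_morph (face_ring_pi Delta 'X_j).
by exists (map_poly x q) => t; rewrite -qE.
Qed.

(** Along a polynomial curve [c], the flow depends polynomially on the time and on
    the parameter of the curve: a regular function on the line times the variety
    has coefficients in the face ring, and these pull back along [c] to
    polynomials in [s].  The time is the outer variable of [Q]. *)
Lemma flow_along_curve (w : 'I_n -> {poly k}) (c : k -> point A) j :
  (forall s i, coord (c s) i = (w i).[s]) ->
  exists Q : {poly {poly k}},
    forall t s, coord (mu t (c s)) j = Q.[t%:P].[s].
Proof.
move=> cw; have [q qE] := mu_morph (face_ring_pi Delta 'X_j).
pose ev := mmap (@polyC k) w.
have evE s p : (ev p).[s] = p.@[coord (c s)].
  apply: (@mpoly_rmorph_ext k n k (horner_eval s \o ev) (meval (coord (c s)))).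
    by move=> a; rewrite /= mevalC /ev mmapC /horner_eval hornerC.
  by move=> i; rewrite /= mevalXU /ev mmapX mmap1U cw.
exists (\poly_(i < size q) ev (repr q`_i)) => t s.
rewrite [LHS]qE (@horner_coef_wide _ (size q)) ?size_poly //.
rewrite [in RHS]horner_poly horner_sum.
apply: eq_bigr => i _; rewrite coef_map -polyC_exp hornerM hornerC evE.
by rewrite -point_pi face_ring_piK.
Qed.

(** Join [x] to the indicator vector of [F] by a line [c] inside the subspace of
    [F].  For [j] outside [F], adjoining [j] to [F] gives a non-face, so the
    product of the coordinate [j] with all coordinates in [F] vanishes on every
    [mu t (c s)].  As polynomials in [t] and [s], the factors from [F] are
    nonzero: at time 0 and [s = 1] they equal 1.  The ring of such polynomials
    is a domain, hence the factor of [j] is zero, in particular at [s = 0]. *)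
Lemma facet_invariant F x t j :
  F \in facets Delta -> coord_support (coord x) \subset F -> j \notin F ->
  coord (mu t x) j = 0.
Proof.
move=> FD xF jF.
pose w i : {poly k} := if i \in F then (coord x i)%:P + (1 - coord x i)%:P * 'X
                       else 0.
have wD s : coord_support (fun i => (w i).[s]) \in faces Delta.
  apply: (face_closed (facet_face FD)); apply/subsetP => i; rewrite inE /w.
  by case: ifP; rewrite // horner0 eqxx.
pose c s := projT1 (cid (point_exists (wD s))).
have cE s i : coord (c s) i = (w i).[s] by rewrite /c; case: cid.
have c0 : c 0 = x.
  apply: point_ext => i; rewrite cE /w; case: ifP => iF.
    by rewrite !hornerE.
  apply/esym/eqP; rewrite horner0; apply: contraFT iF => xi.
  by apply: (subsetP xF); rewrite inE.
have /choice[Q QE] i := flow_along_curve i cE.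
have Qprod : Q j * \prod_(i in F) Q i = 0.
  apply: poly2_vanish_eq0 => t' s; rewrite hornerM horner_prod hornerM horner_prod.
  rewrite -QE (eq_bigr (fun i => coord (mu t' (c s)) i)) => [|i _]; last first.
    by rewrite -QE.
  apply/eqP; apply: contraNT (facet_max FD jF); rewrite mulf_eq0 negb_or.
  case/andP => yj yF; apply: face_closed (coord_support_face (mu t' (c s))) _.
  apply/subsetP => i; rewrite in_setU1 inE => /orP[/eqP-> //|iF].
  by apply: contraNneq yF => yi; rewrite (bigD1 i) //= yi mul0r.
have QF : \prod_(i in F) Q i != 0.
  apply/prodf_neq0 => i iF; apply/eqP => Qi0.
  have := QE i 0 1; rewrite Qi0 !horner0 mu_act.1 cE /w iF.
  rewrite hornerD hornerM hornerX !hornerC mulr1 addrC subrK.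
  by move/eqP; rewrite oner_eq0.
move/eqP: Qprod; rewrite mulf_eq0 (negPf QF) orbF => /eqP Qj0.
by rewrite -c0 QE Qj0 !horner0.
Qed.

Context (clE : forall S, S \in faces Delta -> cl Delta S = S).

(** The support of [x] being closed, some facet above it avoids [j]; the orbit
    of [x] stays in the subspace of that facet. *)
Lemma zero_coord_fixed x t j : coord x j = 0 -> coord (mu t x) j = 0.
Proof.
move=> xj; apply/eqP; apply: contraT => yj.
suff : j \in cl Delta (coord_support (coord x)).
  by rewrite clE ?coord_support_face // inE xj eqxx.
apply/bigcapP => F; rewrite inE => /andP[FD xF].
by apply: contraNT yj => jF; rewrite (facet_invariant t FD).
Qed.

Lemma action_trivial t x : mu t x = x.
Proof.
apply: point_ext => j; have [xj|xj] := eqVneq (coord x j) 0.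
  by rewrite xj zero_coord_fixed.
have [p pE] := orbit_poly x j.
(* A zero of p at time s would, flowing back by -s, force coord x j = 0. *)
rewrite -[in RHS](mu_act.1 x) !pE; apply: poly_no_root_const => s.
rewrite -pE; apply: contra_neq xj => yj.
by have := zero_coord_fixed (- s) yj; rewrite -mu_act.2 addNr mu_act.1.
Qed.
End Action.

End Points.

Theorem corollary3p8 (k : closedFieldType) (char0 : [pchar k] =i pred0)
    (n : nat) (n_gt0 : (0 < n)%N) (Delta : simplicial_complex n) :
  (rigid (face_ring k Delta) <-> fully_hidden Delta) /\
  (fully_hidden Delta <-> faces_are_intersections_of_facets Delta).
Proof.
split; last by rewrite hidden_clP intersections_clP.
split=> [rig F FD | /hidden_clP clE [mu [mu_morph mu_act [t [x []]]]]]; last first.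
  exact: action_trivial.
rewrite /hidden FD; apply/negP => /andP[_ /existsP[i /existsP[S /andP[iS _]]]].
exact: (exposed_not_rigid iS rig).
Qed.
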